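(* If $n\ge 6$, then for every $p$ with $1\le p\le n-4$ the iterated line graphs $\mathcal{L}^k\big(Ka_n(p)\big)$ have property $\varrho$ for every $k\ge 1$.
   Context: For $n\ge 3$, let $v$ be a vertex of the complete graph $K_n$ and $e_1,\dots,e_p$ ($1\le p\le n-1$) distinct edges incident to $v$; $Ka_n(p)$ is the graph obtained from $K_n$ by deleting $e_1,\dots,e_p$. $\mathcal{L}^k$ is the $k$-th iterated line graph. A graph has property $\varrho$ if all its negative adjacency eigenvalues equal $-2$. *)

(* Defs.v *)
From HB Require Import structures.
From mathcomp Require Import all_boot all_order all_algebra.
From mathcomp Require Import reals.

Set Implicit Arguments.
Unset Strict Implicit.
Unset Printing Implicit Defensive.

Import Order.TTheory GRing.Theory Num.Theory.

Record sgraph := SGraph {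
  vertex :> finType;
  adj : rel vertex;
  adj_sym : symmetric adj;
  adj_irrefl : irreflexive adj }.

Arguments adj : clear implicits.

Definition edges (G : sgraph) : {set {set G}} :=
  [set e : {set G} | [exists x, exists y, adj G x y && (e == [set x; y])]].

Definition edges_at (G : sgraph) (v : G) : {set {set G}} :=
  [set e in edges G | v \in e].

Section Complete.
Variable n : nat.

Definition complete_adj : rel 'I_n := fun x y => x != y.

Lemma complete_adj_sym : symmetric complete_adj.
Proof. by move=> x y; rewrite /complete_adj eq_sym. Qed.

Lemma complete_adj_irrefl : irreflexive complete_adj.
Proof. by move=> x; rewrite /complete_adj eqxx. Qed.

Definition complete_graph : sgraph :=
  SGraph complete_adj_sym complete_adj_irrefl.
End Complete.

Section DeleteEdges.
Variables (G : sgraph) (D : {set {set G}}).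

Definition delete_adj : rel G :=
  fun x y => adj G x y && ([set x; y] \notin D).

Lemma delete_adj_sym : symmetric delete_adj.
Proof. by move=> x y; rewrite /delete_adj adj_sym setUC. Qed.

Lemma delete_adj_irrefl : irreflexive delete_adj.
Proof. by move=> x; rewrite /delete_adj adj_irrefl. Qed.

Definition delete_edges : sgraph := SGraph delete_adj_sym delete_adj_irrefl.
End DeleteEdges.

(* G is a copy of Ka_n(p); the choice of the vertex v and of the p edges at v
   only matters up to isomorphism, so every choice is admitted. *)
Definition is_Ka (n p : nat) (G : sgraph) : Prop :=
  exists (v : complete_graph n) (D : {set {set complete_graph n}}),
    [/\ D \subset edges_at v, #|D| = p & G = delete_edges D].

Section LineGraph.
Variable G : sgraph.

Definition line_adj : rel {e : {set G} | e \in edges G} :=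
  fun e f => (e != f) && (val e :&: val f != set0).

Lemma line_adj_sym : symmetric line_adj.
Proof. by move=> e f; rewrite /line_adj eq_sym setIC. Qed.

Lemma line_adj_irrefl : irreflexive line_adj.
Proof. by move=> e; rewrite /line_adj eqxx. Qed.

Definition line_graph : sgraph := SGraph line_adj_sym line_adj_irrefl.
End LineGraph.

Definition iterated_line_graph (k : nat) (G : sgraph) : sgraph :=
  iter k line_graph G.

Local Open Scope ring_scope.

Definition adjacency_matrix (R : realType) (G : sgraph) : 'M[R]_#|G| :=
  \matrix_(i, j) (adj G (enum_val i) (enum_val j))%:R.

Definition property_rho (R : realType) (G : sgraph) : Prop :=
  forall a : R, eigenvalue (adjacency_matrix R G) a -> a < 0 -> a = - 2%:R.

(* Main.v *)
(** The adjacency matrix of the line graph of [G] is [B^T B - 2], with [B] the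
    incidence matrix of [G], so its eigenvalues other than -2 are [q - 2] for
    nonzero eigenvalues [q] of the signless Laplacian [B B^T]; it suffices that
    [B B^T >= 2]. If [G] is itself a line graph then
    [B B^T = (degrees) + (adjacency) >= (min degree) - 2], and a line graph of a
    graph of minimum degree at least 3 has minimum degree at least 4, which
    settles all [k >= 2]. For [k = 1], with [t] the value of a vector [y] at the
    vertex [v], the bound for [Ka_n(p)] reads
    [2 t^2 <= (n - 5) sum y^2 + (sum y)^2 + sum_(x ~ v) (y x + t)^2], the first
    two sums being over [x <> v]; it is proved by completing squares. *)

Require Import Defs.
From HB Require Import structures.
From mathcomp Require Import all_boot all_order all_algebra.
From mathcomp Require Import reals.
From mathcomp Require Import ring lra zify.

Set Implicit Arguments.
Unset Strict Implicit.
Unset Printing Implicit Defensive.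

Import Order.TTheory GRing.Theory Num.Theory.

(** * Incidence counts: the entries of [B B^T] and [B^T B] *)

Section Combinatorics.
Variable G : sgraph.
Implicit Types (x y z : G) (e f : line_graph G).

Definition incident x e : bool := x \in val e.

Definition degree x : nat := #|[set z | adj G x z]|.

Lemma edge_in x y : adj G x y -> [set x; y] \in edges G.
Proof.
move=> xy; rewrite inE; apply/existsP; exists x; apply/existsP; exists y.
by rewrite xy eqxx.
Qed.

Lemma adj_neq x y : adj G x y -> x != y.
Proof. by apply: contraTneq => ->; rewrite adj_irrefl. Qed.

Lemma edgeP e : exists x y, adj G x y /\ val e = [set x; y].
Proof.
have /[!inE] /existsP[x /existsP[y /andP[xy /eqP ee]]] := valP e.
by exists x, y.
Qed.

Lemma edge_pairP e x z : x != z -> incident x e -> incident z e ->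
  val e = [set x; z] /\ adj G x z.
Proof.
rewrite /incident; have [a [b [ab ->]]] := edgeP e.
rewrite !inE => xz /orP[] /eqP ex /orP[] /eqP ez; subst => //.
- by rewrite eqxx in xz.
- by rewrite setUC adj_sym.
- by rewrite eqxx in xz.
Qed.

Definition mk_edge x z (xz : adj G x z) : line_graph G :=
  exist (fun s : {set G} => s \in edges G) [set x; z] (edge_in xz).

Lemma card_incident x : #|[set e | incident x e]| = degree x.
Proof.
rewrite -(card_imset _ val_inj) /degree.
have inj : {in [set z | adj G x z] &, injective (fun z => [set x; z])}.
  move=> z w /[!inE] xz xw /setP/(_ z); rewrite !inE eqxx orbT.
  by move/esym/orP=> [] /eqP // E; move: xz; rewrite E adj_irrefl.
rewrite -(card_in_imset inj); apply: eq_card => s.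
apply/imsetP/imsetP => [[e /[!inE] xe ->]|[z /[!inE] xz ->]].
  move: xe; rewrite /incident; have [a [b [ab ->]]] := edgeP e.
  rewrite !inE => /orP[] /eqP ->; first by exists b; rewrite ?inE.
  by exists a; rewrite ?inE 1?adj_sym 1?setUC.
by exists (mk_edge xz); rewrite // inE /incident /= !inE eqxx.
Qed.

(** The off-diagonal entries of [B B^T]; an edge is determined by its two ends. *)
Lemma card_incident2 x z : x != z ->
  #|[set e | incident x e & incident z e]| = adj G x z.
Proof.
move=> xz; case: (boolP (adj G x z)) => [axz|naxz].
  rewrite -[RHS](cards1 (mk_edge axz)); apply: eq_card => e; rewrite !inE.
  apply/andP/eqP => [[xe ze]|->].
    by apply: val_inj => /=; have [] := edge_pairP xz xe ze.
  by rewrite /incident /= !inE !eqxx orbT.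
apply/eqP; rewrite cards_eq0; apply/eqP/setP=> e; rewrite !inE.
by apply: contraNF naxz => /andP[xe ze]; have [] := edge_pairP xz xe ze.
Qed.

(** The entries of [B^T B]: an edge has two ends, and two edges with two common vertices
    coincide. *)
Lemma card_edge_meet e f :
  #|[set x | incident x e & incident x f]| = (e == f).*2 + adj (line_graph G) e f.
Proof.
have -> : [set x | incident x e & incident x f] = val e :&: val f.
  by apply/setP=> x; rewrite !inE.
rewrite /= /line_adj; have [<-|ef] /= := eqVneq e f.
  rewrite setIid; have [x [y [xy ->]]] := edgeP e.
  by rewrite cards2 adj_neq.
rewrite add0n -cards_eq0 -lt0n.
case: ltnP => [c0|]; last by rewrite leqn0 => /eqP ->.
apply/eqP; rewrite eqn_leq c0 andbT; apply: contraNT ef.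
rewrite -ltnNge => /card_gt1P[x [z [/setIP[xe xf] /setIP[ze zf] xz]]].
apply/eqP/val_inj.
by have [-> _] := edge_pairP xz xe ze; have [-> _] := edge_pairP xz xf zf.
Qed.

End Combinatorics.

(** An edge [e] joining [u] and [v] meets at least two further edges at each end, and these two
    families are disjoint because only [e] contains both ends. *)
Lemma line_degree_ge (G : sgraph) :
  (forall x : G, 3 <= degree x) -> forall e : line_graph G, 4 <= degree e.
Proof.
move=> dG e; have [u [v [uv ee]]] := edgeP e.
pose A x := [set f : line_graph G | incident x f] :\ e.
have ue : incident u e by rewrite /incident ee !inE eqxx.
have ve : incident v e by rewrite /incident ee !inE eqxx orbT.
have cA x : incident x e -> 2 <= #|A x|.
  move=> xe; have := cardsD1 e [set f : line_graph G | incident x f].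
  by rewrite inE xe card_incident -/(A x) => E; move: (dG x); rewrite E.
have dis : A u :&: A v = set0.
  apply/setP=> f; rewrite !inE; apply/negP => /andP[/andP[fe uf] /andP[_ vf]].
  move/negP: fe; apply; apply/eqP/val_inj; rewrite ee.
  by have [] := edge_pairP (adj_neq uv) uf vf.
apply: (@leq_trans #|A u :|: A v|).
  by rewrite cardsU dis cards0 subn0 (leq_add (cA u ue) (cA v ve)).
apply/subset_leq_card/subsetP=> f; rewrite !inE => /orP[] /andP[fe xf];
  rewrite /= /line_adj eq_sym fe; apply/set0Pn.
  by exists u; apply/setIP.
by exists v; apply/setIP.
Qed.

Local Open Scope ring_scope.

(** * Quadratic forms of the signless Laplacian *)

Section QuadraticForm.
Variables (R : realType) (G : sgraph).
Implicit Types (y : G -> R) (g : line_graph G -> R).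

(** The entry of [B^T y] at [e]; likewise [star_sum g] is [B g]. *)
Definition edge_sum y (e : line_graph G) : R := \sum_(x | incident x e) y x.

Definition star_sum g (x : G) : R := \sum_(e | incident x e) g e.

(* The smallest eigenvalue of the signless Laplacian of [G] is at least 2. *)
Definition signless_gap : Prop :=
  forall y, 2 * \sum_x y x ^+ 2 <= \sum_e edge_sum y e ^+ 2.

Lemma sum_sqr_edge_sum y :
  \sum_e edge_sum y e ^+ 2 =
  \sum_x (degree x)%:R * y x ^+ 2 + \sum_x \sum_z (adj G x z)%:R * (y x * y z).
Proof.
have sqE e : edge_sum y e ^+ 2 =
    \sum_x \sum_z (incident x e && incident z e)%:R * (y x * y z).
  rewrite expr2 /edge_sum big_mkcond mulr_suml; apply: eq_bigr => x _.
  rewrite [X in _ * X]big_mkcond mulr_sumr; apply: eq_bigr => z _.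
  by case: incident; case: incident; rewrite /= ?mul0r ?mulr0 ?mul1r.
under eq_bigr do rewrite sqE.
rewrite exchange_big /= -big_split /=; apply: eq_bigr => x _.
rewrite exchange_big /= (bigD1 x) //= [X in _ = _ + X](bigD1 x) //=.
rewrite adj_irrefl mul0r add0r; congr (_ + _).
  under eq_bigr do rewrite andbb.
  rewrite -mulr_suml -natr_sum -big_mkcond sum1dep_card /= -expr2.
  by rewrite card_incident.
apply: eq_bigr => z zx.
rewrite -mulr_suml -natr_sum -big_mkcond sum1dep_card /=.
by rewrite card_incident2 // eq_sym.
Qed.

Lemma edge_sum_star_sum g e :
  edge_sum (star_sum g) e =
  2 * g e + \sum_f (adj (line_graph G) e f)%:R * g f.
Proof.
rewrite /edge_sum /star_sum big_mkcond /=.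
under eq_bigr => x _ do rewrite big_mkcond /=.
transitivity (\sum_x \sum_f (incident x e && incident x f)%:R * g f).
  apply: eq_bigr => x _; case: incident => /=.
    by apply: eq_bigr => f _; case: incident; rewrite ?mul0r ?mul1r.
  by rewrite big1 // => f _; rewrite mul0r.
rewrite exchange_big /=.
have -> : 2 * g e = \sum_f (e == f).*2%:R * g f.
  rewrite (bigD1 e) //= eqxx big1 ?addr0 // => f fe.
  by rewrite eq_sym (negbTE fe) mul0r.
rewrite -big_split /=; apply: eq_bigr => f _.
rewrite -mulrDl -natrD -card_edge_meet -mulr_suml -natr_sum -big_mkcond.
by rewrite sum1dep_card.
Qed.

(** [B] and [B^T] are adjoint. *)
Lemma sum_star_sum g y :
  \sum_x star_sum g x * y x = \sum_e g e * edge_sum y e.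
Proof.
under eq_bigr do rewrite /star_sum mulr_suml.
under [RHS]eq_bigr do rewrite /edge_sum mulr_sumr.
by rewrite [LHS](exchange_big_dep predT).
Qed.

End QuadraticForm.

(** With [A] the adjacency matrix of the line graph, [|B y|^2 >= 0] reads [A >= -2]; the degrees in
    the line graph contribute at least 4. *)
Lemma line_signless_gap (R : realType) (G : sgraph) :
  (forall x : G, 3 <= degree x)%N -> signless_gap R (line_graph G).
Proof.
move=> dG y; rewrite sum_sqr_edge_sum.
have : 0 <= \sum_x star_sum y x * star_sum y x.
  by apply: sumr_ge0 => x _; rewrite -expr2 sqr_ge0.
rewrite sum_star_sum.
under eq_bigr do rewrite edge_sum_star_sum mulrDr mulr_sumr.
rewrite big_split /=.
have dge : 4 * \sum_e y e ^+ 2 <= \sum_e (degree e)%:R * y e ^+ 2.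
  rewrite mulr_sumr; apply: ler_sum => e _.
  by rewrite ler_wpM2r ?sqr_ge0 // ler_nat line_degree_ge.
have E1 : \sum_e y e * (2 * y e) = 2 * \sum_e y e ^+ 2.
  by rewrite mulr_sumr; apply: eq_bigr => e _; ring.
have E2 : \sum_e \sum_f y e * ((adj (line_graph G) e f)%:R * y f) =
          \sum_e \sum_f (adj (line_graph G) e f)%:R * (y e * y f).
  by apply: eq_bigr => e _; apply: eq_bigr => f _; ring.
rewrite E1 E2; move: dge.
set a := \sum_e y e ^+ 2; set b := (X in _ -> _ <= _ + X -> _).
set c := (X in _ <= X -> _).
change (4 * a <= c -> 0 <= 2 * a + b -> 2 * a <= c + b); lra.
Qed.

(** * From the gap to eigenvalues of the line graph *)

Lemma eigenvalue_adjacencyP (R : realType) (G : sgraph) (a : R) :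
  eigenvalue (adjacency_matrix R G) a ->
  exists2 g : G -> R, (exists x, g x != 0) &
    forall x, \sum_z (adj G x z)%:R * g z = a * g x.
Proof.
case/eigenvalueP => w wA w0.
exists (fun x => w 0 (enum_rank x)).
  have [i wi] : exists i, w 0 i != 0.
    apply/existsP; apply: contraNT w0; rewrite negb_exists => /forallP w0.
    by apply/eqP/rowP => i; rewrite mxE; apply/eqP/negPn.
  by exists (enum_val i); rewrite enum_valK.
move=> x; have /rowP/(_ (enum_rank x)) := wA; rewrite !mxE => <-.
rewrite (reindex (@enum_rank G)) /=; last first.
  by exists enum_val => ? _; rewrite ?enum_rankK ?enum_valK.
by apply: eq_bigr => z _; rewrite !mxE !enum_rankK mulrC adj_sym.
Qed.

(** For an eigenvector [g], the vector [y = B g] satisfies [B^T y = (a + 2) g] and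
    [|B^T y|^2 = (a + 2) |y|^2]. The gap gives [2 |y|^2 <= (a + 2) |y|^2], so [a < 0] forces
    [y = 0], hence [(a + 2) g = 0]. *)
Lemma signless_gap_rho (R : realType) (G : sgraph) :
  signless_gap R G -> property_rho R (line_graph G).
Proof.
move=> gap a /eigenvalue_adjacencyP[g [e0 ge0] ga] a0.
have es e : edge_sum (star_sum g) e = (a + 2) * g e.
  by rewrite edge_sum_star_sum ga; ring.
have := gap (star_sum g).
have -> : \sum_e edge_sum (star_sum g) e ^+ 2 =
    (a + 2) * \sum_x star_sum g x ^+ 2.
  under [X in _ = _ * X]eq_bigr do rewrite expr2.
  rewrite sum_star_sum mulr_sumr; apply: eq_bigr => e _; rewrite es; ring.
set s := \sum_x _ => gap_s.
have s_ge0 : 0 <= s by apply: sumr_ge0 => x _; rewrite sqr_ge0.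
have s0 : s = 0 by apply/eqP; rewrite eq_le s_ge0 andbT; nra.
have y0 x : star_sum g x = 0.
  apply/eqP; rewrite -sqrf_eq0; apply/eqP.
  by apply: (psumr_eq0P _ s0) => // i _; rewrite sqr_ge0.
have := es e0; rewrite /edge_sum big1 => [|x _]; last exact: y0.
by move/esym/eqP; rewrite mulf_eq0 (negbTE ge0) orbF addr_eq0 => /eqP ->.
Qed.

(** Each edge is counted once per orientation, which avoids choosing an order of its ends. *)
Lemma sum_sqr_edge_sum2 (R : realType) (G : sgraph) (y : G -> R) :
  2 * \sum_e edge_sum y e ^+ 2 =
  \sum_x \sum_z (adj G x z)%:R * (y x + y z) ^+ 2.
Proof.
have degE : \sum_x (degree x)%:R * y x ^+ 2 =
    \sum_x \sum_z (adj G x z)%:R * y x ^+ 2.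
  apply: eq_bigr => x _; rewrite -mulr_suml -natr_sum -big_mkcond.
  by rewrite sum1dep_card.
have degE' : \sum_x (degree x)%:R * y x ^+ 2 =
    \sum_x \sum_z (adj G x z)%:R * y z ^+ 2.
  rewrite degE exchange_big; apply: eq_bigr => x _; apply: eq_bigr => z _.
  by rewrite adj_sym.
rewrite sum_sqr_edge_sum mulrDr [2 * (\sum_x _ * _ ^+ 2)]mulr_natl mulr2n.
rewrite {1}degE degE' mulr_sumr -!big_split /=; apply: eq_bigr => x _.
rewrite mulr_sumr -!big_split /=; apply: eq_bigr => z _; ring.
Qed.

(** * Complete graphs with edges deleted at one vertex *)

Section DeletedStar.
Variables (n : nat) (v : complete_graph n) (D : {set {set complete_graph n}}).
Hypothesis Dv : D \subset edges_at v.
Let G := delete_edges D.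
Let v' : G := v.

Lemma delete_adj_off (x z : G) : x != v' -> z != v' -> adj G x z = (x != z).
Proof.
move=> xv zv; rewrite /= /delete_adj /= /complete_adj.
have [//|xz] /= := eqVneq x z.
apply/negP => /(subsetP Dv); rewrite inE => /andP[_].
by rewrite !inE ![v == _]eq_sym (negbTE xv) (negbTE zv).
Qed.

(** The map sending [z] to the edge from [v] to [z] is a bijection from the lost neighbours of [v]
    onto [D]. *)
Lemma delete_degree_center : (degree v' + #|D| = n.-1)%N.
Proof.
have cN : #|[set z : G | v' != z]| = n.-1.
  rewrite -[in RHS](card_ord n) -(cardsC1 v); apply: eq_card => z.
  by rewrite !inE eq_sym.
rewrite -cN -(cardsID [set z : G | [set v; z] \in D]) addnC; congr (_ + _)%N.
  have inj : {in [set z : G | v' != z] :&: [set z : G | [set v; z] \in D] &,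
      injective (fun z : complete_graph n => [set v; z])}.
    move=> z w /[!inE] /andP[vz _] _ /setP/(_ z); rewrite !inE eqxx orbT.
    by move/esym/orP=> [] /eqP // E; move: vz; rewrite E eqxx.
  rewrite -(card_in_imset inj); apply: eq_card => s; apply/idP/imsetP.
    move=> sD; have := subsetP Dv s sD; rewrite !inE.
    case/andP => /existsP[a /existsP[b /andP[ab /eqP E]]]; move: sD ab.
    rewrite {s}E !inE /= /complete_adj => sD ab /orP[] /eqP E; subst.
      by exists b; rewrite // !inE ab.
    by exists a; rewrite 1?setUC // !inE 1?eq_sym ab setUC.
  by case=> z /[!inE] /andP[_ zD] ->.
by apply: eq_card => z; rewrite !inE andbC.
Qed.

Lemma delete_degree_off (x : G) : x != v' -> (n.-2 <= degree x)%N.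
Proof.
move=> xv.
have -> : n.-2 = #|[set~ v] :\ x|.
  have := cardsD1 x [set~ v]; rewrite cardsC1 card_ord !inE xv /= => ->.
  by [].
apply/subset_leq_card/subsetP=> z; rewrite !inE => /andP[zx zv].
by rewrite delete_adj_off // eq_sym.
Qed.

(** Off [v] the graph is complete on [n - 1] vertices, with signless Laplacian [(n - 3) I + J], [J]
    the all-ones matrix; the last sum collects the edges at [v]. *)
Lemma delete_sum_sqr_edge_sum (R : realType) (y : G -> R) :
  \sum_e edge_sum y e ^+ 2 =
  (n.-1%:R - 2) * (\sum_(x | x != v') y x ^+ 2) + (\sum_(x | x != v') y x) ^+ 2
  + \sum_(x | x != v') (adj G v' x)%:R * (y x + y v') ^+ 2.
Proof.
have two0 : 2 != 0 :> R by rewrite pnatr_eq0.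
apply: (mulfI two0); rewrite sum_sqr_edge_sum2 (bigD1 v') //=.
rewrite (bigD1 v') //= [delete_adj D v' v']delete_adj_irrefl mul0r add0r.
set t := y v'.
have rowE (x : G) : x != v' ->
    \sum_z (delete_adj D x z)%:R * (y x + y z) ^+ 2 =
    (delete_adj D v' x)%:R * (y x + t) ^+ 2 +
    (\sum_(z | z != v') (y x + y z) ^+ 2 - 4 * y x ^+ 2).
  move=> xv; rewrite (bigD1 v') //= [delete_adj D x v']delete_adj_sym; congr (_ + _).
  rewrite (bigD1 x) //= [in RHS](bigD1 x) //=.
  rewrite [delete_adj D x x]delete_adj_irrefl mul0r add0r.
  (* The full sum over [z] includes the diagonal term [z = x], which is no edge; this is what
     [4 * y x ^+ 2] removes. *)
  have -> : (y x + y x) ^+ 2 = 4 * y x ^+ 2 by ring.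
  rewrite addrAC subrr add0r; apply: eq_bigr => z /andP[zv zx].
  by rewrite [delete_adj D x z]delete_adj_off // eq_sym zx mul1r.
rewrite (eq_bigr _ rowE) big_split /=.
have cN : #|[pred z : G | z != v']| = n.-1.
  by rewrite -[in RHS](card_ord n) -(cardC1 v).
have sumE : \sum_(x | x != v')
    (\sum_(z | z != v') (y x + y z) ^+ 2 - 4 * y x ^+ 2) =
    2 * ((n.-1%:R - 2) * (\sum_(x | x != v') y x ^+ 2) +
      (\sum_(x | x != v') y x) ^+ 2).
  have sqE (x : G) : \sum_(z | z != v') (y x + y z) ^+ 2 - 4 * y x ^+ 2 =
      (n.-1%:R - 4) * y x ^+ 2 + 2 * y x * (\sum_(z | z != v') y z) +
      \sum_(z | z != v') y z ^+ 2.
    under eq_bigr do rewrite sqrrD.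
    rewrite !big_split /= sumr_const cN -!mulr_sumr; ring.
  under eq_bigr do rewrite sqE.
  rewrite !big_split /= sumr_const cN -mulr_natl -mulr_sumr -mulr_suml -mulr_sumr.
  ring.
rewrite sumE.
under eq_bigr do rewrite [t + _]addrC.
ring.
Qed.

End DeletedStar.

(** * The gap for [Ka_n(p)] *)

Section Ka.
Variables (n : nat) (v : complete_graph n) (D : {set {set complete_graph n}}).
Hypotheses (hn : (6 <= n)%N) (Dv : D \subset edges_at v).
Hypotheses (hD : (1 <= #|D| <= n - 4)%N).
Let G := delete_edges D.
Let v' : G := v.

Lemma Ka_degree (x : G) : (3 <= degree x)%N.
Proof.
have [->|xv] := eqVneq x v'; last first.
  by apply: leq_trans (delete_degree_off Dv xv); lia.
have := delete_degree_center Dv; rewrite -/G -/v'.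
by move: (degree _) => d; move: hD; lia.
Qed.

Lemma Ka_signless_gap (R : realType) : signless_gap R G.
Proof.
move=> y; rewrite (delete_sum_sqr_edge_sum Dv) (bigD1 v') //= -/v'.
set t := y v'; set S := \sum_(x | x != v') y x.
set N := fun x : G => delete_adj D v' x.
have dE := delete_degree_center Dv; set d := degree _ in dE.
have sumN (c : R) : \sum_(x : G | x != v') (N x)%:R * c = d%:R * c.
  rewrite -mulr_suml -natr_sum -big_mkcondr /d /degree sum1dep_card.
  congr (_%:R * _); apply: eq_card => x; rewrite !inE.
  rewrite andb_idl // => vx; rewrite eq_sym; exact: (@adj_neq G v' x).
have cN : #|[pred z : G | z != v']| = n.-1.
  by rewrite -[in RHS](card_ord n) -(cardC1 v).
have [/andP[/eqP n6 /eqP d3]|h] := boolP ((n == 6) && (d == 3))%N.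
  (* Equality holds for [y = -t/3] on the three neighbours of [v] and
     [y = t/3] on its two non-neighbours; [S ^+ 2] is bounded by its tangent
     at that point, which decouples the vertices. *)
  have m5 : n.-1 = 5%N by rewrite n6.
  have tang : - (2/3) * t * S - 1/9 * t ^+ 2 <= S ^+ 2.
    have := sqr_ge0 (S + t / 3); nra.
  (* Three neighbours and two non-neighbours give [(3 * 7/9 - 2 * 1/9) t^2 = 19/9 t^2]; the constant
     of the tangent takes [1/9 t^2], leaving exactly [2 t^2]. *)
  have : \sum_(x : G | x != v') ((N x)%:R * (8/9 * t ^+ 2) - 1/9 * t ^+ 2) <=
     \sum_(x : G | x != v') (y x ^+ 2 + (N x)%:R * (y x + t) ^+ 2
        + - (2/3) * t * y x).
    apply: ler_sum => x _; case: (N x); rewrite ?mul0r ?mul1r.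
      have := sqr_ge0 (y x + t / 3); nra.
    have := sqr_ge0 (y x - t / 3); nra.
  rewrite !big_split /= -mulr_sumr -/S sumN sumr_const cN d3 m5.
  set q := \sum_(x | x != v') y x ^+ 2.
  set r := \sum_(x | x != v') _ * _.
  move: tang; nra.
(* Elsewhere the term [S ^+ 2] is not needed. *)
have key (c b : R) : 0 <= b -> b <= n.-1%:R - 4 -> 2 <= d%:R * c ->
    (forall s, c * t ^+ 2 <= b * s ^+ 2 + (s + t) ^+ 2) ->
    2 * (t ^+ 2 + \sum_(x | x != v') y x ^+ 2) <=
    (n.-1%:R - 2) * (\sum_(x | x != v') y x ^+ 2) + S ^+ 2
    + \sum_(x | x != v') (N x)%:R * (y x + t) ^+ 2.
  move=> b0 bn dc cb.
  have : \sum_(x : G | x != v') (N x)%:R * (c * t ^+ 2) <=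
     \sum_(x : G | x != v') (b * y x ^+ 2 + (N x)%:R * (y x + t) ^+ 2).
    apply: ler_sum => x _; case: (N x); rewrite ?mul0r ?mul1r //.
    by rewrite addr0 mulr_ge0 ?sqr_ge0.
  rewrite big_split /= -mulr_sumr sumN.
  set q := \sum_(x | x != v') y x ^+ 2.
  have q0 : 0 <= q by apply: sumr_ge0 => x _; rewrite sqr_ge0.
  have := ler_wpM2r q0 bn; have := ler_wpM2r (sqr_ge0 t) dc.
  have := sqr_ge0 S.
  set r := \sum_(x | x != v') _ * _; rewrite mulrA mulrBl mulrBl; lra.
(* The minimum of [b s^2 + (s + t)^2] over [s] is [b/(b + 1) t^2], so [c = b/(b + 1)]. For [d >= 4],
   [b = 1] suffices; for [d = 3], [b = 2] is needed, and [b <= n - 5] holds since [n = 6] is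
   excluded. *)
have [d4|d3] := leqP 4 d.
  apply: (key (1/2) 1) => //.
  - by rewrite lerBrDr -[1]/(1%:R) -natrD ler_nat; lia.
  - have : 4 <= d%:R :> R by rewrite ler_nat.
    lra.
  - move=> s; have := sqr_ge0 (s + t / 2); nra.
apply: (key (2/3) 2) => //.
- by rewrite lerBrDr -natrD ler_nat; move: h hD; lia.
- have : 3 <= d%:R :> R by rewrite ler_nat; move: h hD; lia.
  lra.
- move=> s; have := sqr_ge0 (s + t / 3); nra.
Qed.

End Ka.

Local Close Scope ring_scope.

Theorem theorem4p12 (R : realType) (n : nat) (hn : 6 <= n)
    (p : nat) (hp : 1 <= p <= n - 4)
    (G : sgraph) (hG : is_Ka n p G)
    (k : nat) (hk : 1 <= k) :
  property_rho R (iterated_line_graph k G).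
Proof.
case: hG => v [D [Dv Dp ->]]; rewrite -Dp in hp.
case: k hk => // k _; apply: signless_gap_rho.
case: k => [|k]; first exact: Ka_signless_gap Dv hp R.
(* Minimum degree at least 3 passes to every iterate. *)
apply: line_signless_gap; elim: k => [|k IH] x; first exact: Ka_degree Dv hp x.
exact: ltnW (line_degree_ge IH x).
Qed.
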